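(* Let $(A_{\mathrm{AdS}}(\rho),\phi(\rho))$ be a proper domain wall solution of AdS$_3$-Einstein-dilaton gravity and let $(A(r),\phi(r))$ be a corresponding proper flat-space domain wall solution. Then the associated flat space holographic $c$-function $$c_{\mathrm{dw}}(r)=\frac{c_{\mathrm M}^{\mathrm{UV}}}{A'(r)},\qquad r\in\mathbb R,$$ is monotonically decreasing when flowing from the UV ($r\to\infty$) to the IR ($r\to-\infty$); that is, $c_{\mathrm{dw}}(r_{\mathrm{UV}})\ge c_{\mathrm{dw}}(r_{\mathrm{IR}})$ whenever $r_{\mathrm{IR}}<r_{\mathrm{UV}}$.
   Context: **Equations of motion.** For a 3d Lorentzian metric $g$, a real scalar $\phi$ and a potential $V$ (action $\frac{1}{16\pi G_N}\int d^3x\sqrt{-g}\,(R-\frac12(\partial\phi)^2-V(\phi))$, Newton constant $G_N>0$): $$R_{\mu\nu}-\tfrac12 g_{\mu\nu}R=\tfrac12\partial_\mu\phi\,\partial_\nu\phi-\tfrac14(\partial\phi)^2g_{\mu\nu}-\tfrac12V(\phi)g_{\mu\nu},\qquad \nabla^2\phi=V'(\phi).$$ **Proper AdS$_3$ domain wall.** A proper domain wall solution of AdS$_3$-Einstein-dilaton gravity is an exact solution of these equations, with some potential of the form $V(\phi)=-2+\frac12m^2\phi^2+\dots$ (higher powers of $\phi$), with metric $ds^2=d\rho^2+e^{2A_{\mathrm{AdS}}(\rho)}(-dt^2+dx^2)$ and $\phi=\phi(\rho)$, $\rho\in\mathbb R$, such that: 1. for $\rho\to\infty$ the metric asymptotes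 to Poincaré patch AdS$_3$ with unit AdS radius, i.e. $A_{\mathrm{AdS}}(\rho)=\rho+\mathrm{const}+o(1)$, and $\phi\to0$; 2. for $\rho\to-\infty$ the metric asymptotes to Poincaré patch AdS$_3$ with AdS radius $\ell_{\mathrm{IR}}$ smaller than one, i.e. $A_{\mathrm{AdS}}(\rho)=\rho/\ell_{\mathrm{IR}}+\mathrm{const}+o(1)$, and $\phi$ approaches a constant (possibly zero); 3. for finite $\rho$ the functions $A_{\mathrm{AdS}}$ and $\phi$ are bounded and real; $A_{\mathrm{AdS}}$ is at least $C^2$ and $\phi$ at least $C^1$. **Proper flat-space domain wall.** A proper flat-space domain wall solution is an exact solution of the same equations with $V=0$, with metric $ds^2=-2e^{A(r)}\,du\,dr+e^{2A(r)}\,d\varphi^2$ and $\phi=\phi(r)$, $r\in\mathbb R$, such that: 1. for $r\to\infty$ the metric asymptotes to the null orbifold $-2\,du\,d\varrho+\varrho^2d\varphi^2$ (with $\varrho=e^{r-r_0}$), i.e. $A(r)=r-r_0+o(1)$ for some constant $r_0$, and $\phi\to0$; 2. for $r\to-\infty$ the metric asymptotes to the null orbifold with a possibly rescaled first term, $-2\lambda\,du\,d\varrho+\varrho^2d\varphi^2$ with some $\lambda>0$ (with $\varrho=e^{(r-r_1)/\lambda}$), i.e. $A(r)=\lambda^{-1}(r-r_1)+o(1)$ for some constant $r_1$, and $\phi$ approaches a constant (possibly zero); 3. for finite $r$ the functions $A$ and $\phi$ are bounded and real; $A$ is at least $C^2$ and $\phi$ at least $C^1$. **Correspondence.** The flat-space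 domain wall corresponding to a given AdS$_3$ domain wall is one whose scalar field $\phi(r)$ is the same function as the AdS$_3$ scalar field $\phi(\rho)$, with $\rho$ renamed $r$. **UV central charge.** $c_{\mathrm M}^{\mathrm{UV}}=3/G_N>0$ is the mixed central charge of the asymptotic $\mathfrak{bms}_3$ algebra at $r\to\infty$. *)

(* Defs.v *)
(* MathComp-Analysis, over an arbitrary R : realType. *)
From HB Require Import structures.
From mathcomp Require Import all_boot all_order all_algebra.
From mathcomp Require Import all_classical all_reals all_analysis.

Set Implicit Arguments.
Unset Strict Implicit.
Unset Printing Implicit Defensive.

Import Order.TTheory GRing.Theory Num.Theory.
Import numFieldNormedType.Exports.

Local Open Scope classical_set_scope.
Local Open Scope ring_scope.

Section Geometry.
Variable R : realType.

(* A point of the coordinate chart R^3. *)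
Local Notation point := 'rV[R]_3.

Definition pd (k : 'I_3) (f : point -> R) (x : point) : R :=
  'D_(delta_mx 0 k) f x.

Definition pderivable (k : 'I_3) (f : point -> R) (x : point) : Prop :=
  derivable f x (delta_mx 0 k).

Section Metric.
(* g x i j = g_ij(x). *)
Variable g : point -> 'M[R]_3.

Definition ginv (x : point) : 'M[R]_3 := invmx (g x).

(* Levi-Civita connection: christoffel a b c x = Gamma^a_(bc)(x). *)
Definition christoffel (a b c : 'I_3) (x : point) : R :=
  2^-1 * \sum_d ginv x a d *
    (pd b (fun y => g y d c) x + pd c (fun y => g y d b) x
     - pd d (fun y => g y b c) x).

(* Sign convention: round spheres have positive, AdS negative curvature. *)
Definition ricci (b c : 'I_3) (x : point) : R :=
  \sum_a (pd a (christoffel a b c) x - pd c (christoffel a b a) x)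
  + \sum_a \sum_d (christoffel a a d x * christoffel d b c x
                   - christoffel a c d x * christoffel d b a x).

Definition scalar_curvature (x : point) : R :=
  \sum_i \sum_j ginv x i j * ricci i j x.

(* (d phi)^2 *)
Definition grad_sq (phi : point -> R) (x : point) : R :=
  \sum_i \sum_j ginv x i j * pd i phi x * pd j phi x.

Definition sqrt_det (x : point) : R := Num.sqrt `|\det (g x)|.

Definition flux (phi : point -> R) (i : 'I_3) (x : point) : R :=
  sqrt_det x * \sum_j ginv x i j * pd j phi x.

(* The Laplace-Beltrami operator in divergence form; unlike
   g^(ij) (d_i d_j phi - Gamma^k_(ij) d_k phi), it does not involve second
   derivatives of phi in directions in which the inverse metric vanishes. *)
Definition laplace_beltrami (phi : point -> R) (x : point) : R :=
  (sqrt_det x)^-1 * \sum_i pd i (flux phi i) x.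

Definition einstein_eq (V : R -> R) (phi : point -> R) (x : point) : Prop :=
  forall i j : 'I_3,
    ricci i j x - 2^-1 * g x i j * scalar_curvature x =
    2^-1 * pd i phi x * pd j phi x - 4^-1 * grad_sq phi x * g x i j
    - 2^-1 * V (phi x) * g x i j.

Definition scalar_eq (V : R -> R) (phi : point -> R) (x : point) : Prop :=
  laplace_beltrami phi x = V^`()%classic (phi x).

(* 'D_v and ^`() are total, so an exact (classical) solution must also assert
   that every derivative entering the equations exists. *)
Record exact_solution (V : R -> R) (phi : point -> R) : Prop := {
  sol_metric_derivable : forall i j k x, pderivable k (fun y => g y i j) x;
  sol_christoffel_derivable :
    forall a b c k x, pderivable k (christoffel a b c) x;
  sol_scalar_derivable : forall k x, pderivable k phi x;
  sol_flux_derivable : forall i x, pderivable i (flux phi i) x;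
  sol_potential_derivable : forall x, derivable V (phi x) 1;
  sol_einstein : forall x, einstein_eq V phi x;
  sol_scalar : forall x, scalar_eq V phi x
}.

End Metric.

Definition mx_of_rows (s : seq (seq R)) : 'M[R]_3 :=
  \matrix_(i, j) nth 0 (nth [::] s i) j.

(* Coordinates (t, x, rho):
   ds^2 = d rho^2 + e^(2 A(rho)) (- dt^2 + dx^2). *)
Definition ads_metric (A : R -> R) (x : point) : 'M[R]_3 :=
  let rho := x 0 (inord 2) in
  mx_of_rows [:: [:: - expR (2 * A rho); 0; 0];
                 [:: 0; expR (2 * A rho); 0];
                 [:: 0; 0; 1]].

(* Coordinates (u, r, varphi):
   ds^2 = - 2 e^(A(r)) du dr + e^(2 A(r)) d varphi^2, hence
   g_ur = g_ru = - e^(A(r)).  The angle varphi is lifted to R: the equations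
   are local and nothing depends on it. *)
Definition flat_metric (A : R -> R) (x : point) : 'M[R]_3 :=
  let r := x 0 (inord 1) in
  mx_of_rows [:: [:: 0; - expR (A r); 0];
                 [:: - expR (A r); 0; 0];
                 [:: 0; 0; expR (2 * A r)]].

Definition ads_scalar (phi : R -> R) (x : point) : R := phi (x 0 (inord 2)).
Definition flat_scalar (phi : R -> R) (x : point) : R := phi (x 0 (inord 1)).

End Geometry.

Section DomainWalls.
Variable R : realType.
Implicit Types (A phi V f : R -> R).

Definition class_C (k : nat) f : Prop :=
  (forall j : nat, (j < k)%N -> forall x, derivable f^`(j)%classic x 1) /\
  continuous f^`(k)%classic.

Definition bounded_at_finite f : Prop :=
  forall a b : R, exists M : R, forall x, a <= x <= b -> `|f x| <= M.

(* V(s) = -2 + (1/2) m^2 s^2 + (higher powers of s) near s = 0.  The remainder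
   is only required to be o(s^2), which covers convergent or asymptotic power
   series as well as non-integer higher powers.  The parameter m2 is the mass
   squared and may be negative. *)
Definition ads_potential V : Prop :=
  exists m2 : R,
    (fun s : R => V s - (- 2 + 2^-1 * m2 * s ^+ 2))
      =o_ (0 : R) (fun s : R => s ^+ 2).

Record proper_ads_wall A phi : Prop := {
  ads_solution : exists2 V, ads_potential V &
    exact_solution (ads_metric A) V (ads_scalar phi);
  ads_UV_metric : exists c : R, A rho - rho @[rho --> +oo] --> c;
  ads_UV_scalar : phi rho @[rho --> +oo] --> (0 : R);
  ads_IR_metric : exists2 l_IR : R, 0 < l_IR < 1 &
    exists c : R, A rho - rho / l_IR @[rho --> -oo] --> c;
  ads_IR_scalar : exists c : R, phi rho @[rho --> -oo] --> c;
  ads_bounded : bounded_at_finite A /\ bounded_at_finite phi;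
  ads_smooth : class_C 2 A /\ class_C 1 phi
}.

Record proper_flat_wall A phi : Prop := {
  flat_solution :
    exact_solution (flat_metric A) (fun=> 0) (flat_scalar phi);
  flat_UV_metric : exists r0 : R, A r - (r - r0) @[r --> +oo] --> (0 : R);
  flat_UV_scalar : phi r @[r --> +oo] --> (0 : R);
  flat_IR_metric : exists2 lambda : R, 0 < lambda &
    exists r1 : R, A r - lambda^-1 * (r - r1) @[r --> -oo] --> (0 : R);
  flat_IR_scalar : exists c : R, phi r @[r --> -oo] --> c;
  flat_bounded : bounded_at_finite A /\ bounded_at_finite phi;
  flat_smooth : class_C 2 A /\ class_C 1 phi
}.

Definition corresponding_scalars (phi_AdS phi : R -> R) : Prop :=
  phi =1 phi_AdS.

(* The mixed central charge of the asymptotic bms_3 algebra. *)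
Definition c_M_UV (G_N : R) : R := 3 / G_N.

Definition c_dw (G_N : R) A (r : R) : R := c_M_UV G_N / A^`()%classic r.

End DomainWalls.

(* Main.v *)
(* With V = 0 the rr-component of Einstein's equations for the flat metric is
   Raychaudhuri's equation A'' = - phi'^2 / 2, since g_rr = 0.  Hence A' is
   nonincreasing and A is concave; as A lies below its tangents, a slope
   A' < 1 anywhere would force A(r) - r to -oo for r -> +oo.  So A' >= 1 > 0,
   and 1 / A' is nondecreasing. *)
Require Import Defs.
From HB Require Import structures.
From mathcomp Require Import all_boot all_order all_algebra.
From mathcomp Require Import all_classical all_reals all_analysis.
From mathcomp Require Import ring lra.

Import Order.TTheory GRing.Theory Num.Theory.
Import numFieldNormedType.Exports.

Local Open Scope classical_set_scope.
Local Open Scope ring_scope.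

(** Moving along axis [k] shifts coordinate [j] by the step if [k = j] and fixes it otherwise, so
    the difference quotients agree before any limit is taken. *)
Lemma pd_coord (R : realType) (h : R -> R) (j k : 'I_3) (x : 'rV[R]_3) :
  pd k (fun y => h (y 0 j)) x = (k == j)%:R * h^`()%classic (x 0 j).
Proof.
rewrite /pd /derive /derive1.
under eq_fun => s do rewrite /= !mxE eqxx /=.
have [_|_] := eqVneq k j; last first.
  rewrite mul0r; under eq_fun => s do rewrite mulr0 add0r subrr scaler0.
  exact: lim_cst.
by under eq_fun => s do rewrite mulr1; rewrite mul1r.
Qed.

Lemma pd_coord_eq (R : realType) (f : 'rV[R]_3 -> R) (h : R -> R)
    (j k : 'I_3) (x : 'rV[R]_3) :
  (forall y, f y = h (y 0 j)) -> pd k f x = (k == j)%:R * h^`()%classic (x 0 j).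
Proof. by move=> fh; rewrite -pd_coord; congr pd; apply/funext. Qed.

Lemma derive1_expR_comp (R : realType) (f : R -> R) (r : R) :
  derivable f r 1 -> (expR \o f)^`()%classic r = f^`()%classic r * expR (f r).
Proof.
move=> df; rewrite (@derive1_comp _ f expR)//.
by rewrite mulrC [in LHS](derive1E expR) derive_val.
Qed.

Lemma inord1E : (inord 1 : 'I_3) = lift ord0 ord0.
Proof. by apply: val_inj; rewrite /= inordK. Qed.

Section FlatMetric.
Context {R : realType}.
Variable A : R -> R.
Hypothesis dA : forall r, derivable A r 1.
Local Notation g := (flat_metric A).
Implicit Types x : 'rV[R]_3.

Lemma ginv_flat x : let r := x 0 (inord 1) in
  ginv g x = mx_of_rows [:: [:: 0; - (expR (A r))^-1; 0];
                            [:: - (expR (A r))^-1; 0; 0];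
                            [:: 0; 0; (expR (2 * A r))^-1]].
Proof.
move=> r; rewrite /ginv; set B := mx_of_rows _.
have e0 (s : R) : expR s != 0 by rewrite gt_eqF ?expR_gt0.
(* For square matrices a right inverse is the inverse, so one product suffices. *)
have gB : g x *m B = 1%:M.
  apply/matrixP => i j; rewrite !mxE !big_ord_recl big_ord0 !mxE -/r.
  by case: i => [[|[|[|i]]] hi] //; case: j => [[|[|[|j]]] hj] //=;
    rewrite ?(mul0r, mulr0, addr0, add0r, mulrNN) ?mulfV.
have ug : g x \in unitmx by have [] := mulmx1_unit gB.
by rewrite -[RHS]mul1mx -(mulVmx ug) -mulmxA gB mulmx1.
Qed.

Lemma pd_flat_metric k i j x : let r := x 0 (inord 1) in
  pd k (fun y => g y i j) x = (k == inord 1)%:R *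
    mx_of_rows [:: [:: 0; - (A^`()%classic r * expR (A r)); 0];
                   [:: - (A^`()%classic r * expR (A r)); 0; 0];
                   [:: 0; 0; 2 * A^`()%classic r * expR (2 * A r)]] i j.
Proof.
move=> r.
have d1 : (expR \o A)^`()%classic r = A^`()%classic r * expR (A r).
  exact: derive1_expR_comp.
have d2A : derivable (2 \*o A) r 1 by apply: derivableM.
have d2 : (expR \o (2 \*o A))^`()%classic r =
    2 * A^`()%classic r * expR (2 * A r).
  rewrite derive1_expR_comp//; congr (_ * _).
  by rewrite !derive1E deriveMl.
have dN : (- (expR \o A))^`()%classic r = - (A^`()%classic r * expR (A r)).
  rewrite -d1 !derive1E deriveN//.
  apply: diff_derivable; apply: differentiable_comp;
    apply/derivable1_diffP => //.
have d0 : (fun _ : R => 0 : R)^`()%classic r = 0 by rewrite derive1_cst.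
rewrite (@pd_coord_eq _ _ (fun s => mx_of_rows [:: [:: 0; - expR (A s); 0];
    [:: - expR (A s); 0; 0]; [:: 0; 0; expR (2 * A s)]] i j) (inord 1))//.
congr (_ * _); rewrite !mxE -/r.
under eq_fun do rewrite mxE.
by case: i => [[|[|[|i]]] hi] //; case: j => [[|[|[|j]]] hj] /=.
Qed.

(** With a lower index r, only Gamma^r_(rr) and Gamma^varphi_(r varphi) survive; in Gamma^u_(ru) the
    two r-derivatives of g_ur cancel. *)
Lemma christoffel_flat_r a c x :
  christoffel g a (inord 1) c x =
  ((a == c) && (a != ord0))%:R * A^`()%classic (x 0 (inord 1)).
Proof.
rewrite /christoffel; under eq_bigr do rewrite !pd_flat_metric.
rewrite ginv_flat; set r := x 0 _.
have e0 (s : R) : expR s != 0 by rewrite gt_eqF ?expR_gt0.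
(* The two exponentials cancel separately, so they become independent nonzero atoms and each entry
   is a rational identity. *)
have := (e0 (A r), e0 (2 * A r)); move: (expR _) (expR _) => e f [ne nf].
rewrite inord1E !big_ord_recl big_ord0 !mxE.
case: a => [[|[|[|a]]] ha] //; case: c => [[|[|[|c]]] hc] //=;
  rewrite -?val_eqE /=; by field; rewrite ?ne ?nf.
Qed.

Lemma christoffel_flatC a b c x : christoffel g a b c x = christoffel g a c b x.
Proof.
rewrite /christoffel; congr (_ * _); apply: eq_bigr => d _; congr (_ * _).
rewrite !pd_flat_metric [X in X - _]addrC; congr (_ - _ * _); rewrite !mxE.
by case: b => [[|[|[|b]]] hb] //; case: c => [[|[|[|c]]] hc].
Qed.

Lemma pd_christoffel_flat_r k a c x :
  pd k (christoffel g a (inord 1) c) x =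
  (k == inord 1)%:R * ((a == c) && (a != ord0))%:R *
  A^`()^`()%classic (x 0 (inord 1)).
Proof.
rewrite -mulrA; have := christoffel_flat_r a c.
case: (_ && _) => [|] gE.
  rewrite (@pd_coord_eq _ _ A^`()%classic (inord 1)) ?mul1r// => y.
  by rewrite gE mul1r.
rewrite (@pd_coord_eq _ _ (cst 0) (inord 1)) ?derive1_cst ?mul0r// => y.
by rewrite gE mul0r.
Qed.

(** The derivative terms give A'' - 2 A''; the quadratic terms are 2 A'^2 - 2 A'^2 and cancel. *)
Lemma ricci_flat_rr x :
  ricci g (inord 1) (inord 1) x = - A^`()^`()%classic (x 0 (inord 1)).
Proof.
rewrite /ricci; set r := x 0 _.
(* Gamma^d_(rr) vanishes unless d = r; symmetry in the lower indices then reduces the trace factor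
   to [christoffel_flat_r]. *)
have gd a d : christoffel g a a d x * christoffel g d (inord 1) (inord 1) x =
    ((a != ord0) && (d == inord 1))%:R * A^`()%classic r ^+ 2.
  rewrite [christoffel g d _ _ _]christoffel_flat_r -/r.
  have [->|_] := eqVneq d (inord 1); last by rewrite andbF !mul0r mulr0.
  rewrite christoffel_flatC christoffel_flat_r -/r inord1E eqxx !andbT !mul1r.
  by rewrite -mulrA.
under eq_bigr do rewrite !pd_christoffel_flat_r -/r.
under [X in _ + X]eq_bigr do
  under eq_bigr do rewrite gd !christoffel_flat_r -/r.
rewrite inord1E !big_ord_recl !big_ord0 -?val_eqE /=.
by rewrite -?val_eqE /=; ring.
Qed.

Lemma grad_flat_r (phi : R -> R) x :
  pd (inord 1) (flat_scalar phi) x = phi^`()%classic (x 0 (inord 1)).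
Proof. by rewrite /flat_scalar pd_coord eqxx mul1r. Qed.

Lemma flat_einstein_rr V (phi : R -> R) x :
  einstein_eq g V (flat_scalar phi) x ->
  A^`()^`()%classic (x 0 (inord 1)) =
  - (2^-1 * phi^`()%classic (x 0 (inord 1)) ^+ 2).
Proof.
move=> /(_ (inord 1) (inord 1)); rewrite ricci_flat_rr grad_flat_r.
(* This removes the scalar curvature, [grad_sq] and potential terms together, whatever [V] is. *)
have -> : g x (inord 1) (inord 1) = 0 by rewrite !mxE inordK.
by lra.
Qed.

End FlatMetric.

Lemma nonincreasing_of_derive1_le0 (R : realType) (f : R -> R) :
  (forall r, derivable f r 1) -> (forall r, f^`()%classic r <= 0) ->
  {homo f : x y /~ x <= y}.
Proof.
move=> df f'le0 y x xy; apply: (@ler0_derive1_nincry _ f x) => //.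
by apply: derivable_within_continuous.
Qed.

Lemma derive1_ge1_of_asymptote (R : realType) (f : R -> R) (c : R) :
  (forall r, derivable f r 1) -> {homo f^`()%classic : x y /~ x <= y} ->
  f r - r @[r --> +oo] --> c -> forall r, 1 <= f^`()%classic r.
Proof.
move=> df f'anti fc r0; rewrite leNgt; apply/negP => f'lt1.
set e := 1 - f^`()%classic r0; have e0 : 0 < e by rewrite subr_gt0.
(* By the mean value theorem and monotonicity of the derivative, [f] lies below its tangent at [r0],
   of slope [1 - e]. *)
have tangent r : r0 <= r -> f r - r <= f r0 - r0 - e * (r - r0).
  rewrite le_eqVlt => /predU1P[<-|r0r]; first by lra.
  have [|s|z] := @MVT _ f f^`()%classic _ _ r0r.
  - by move=> s _; rewrite derive1E; exact: derivableP.
  - by apply: derivable_within_continuous.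
  rewrite in_itv/= => /andP[r0z _] fE.
  have := f'anti _ _ (ltW r0z); rewrite /e; nra.
(* From this threshold on, the tangent bound is at most [c - 1], which contradicts convergence to
   [c]. *)
have [r []] : exists r, r0 + (f r0 - r0 - c + 1) / e <= r /\
    r0 <= r /\ c - 1 < f r - r.
  near (pinfty_nbhs R) => r; exists r; split.
    by near: r; apply: nbhs_pinfty_ge; exact: num_real.
  split; first by near: r; apply: nbhs_pinfty_ge; exact: num_real.
  by near: r; apply: (cvgr_gt _ fc); lra.
rewrite -lerBrDl ler_pdivrMr// => re [/tangent]; lra.
Unshelve. all: by end_near. Qed.

(** Since division by 0 returns 0, the first conjunct certifies that [c_dw] is a genuine
    quotient. *)
Theorem theorem2 (R : realType) (G_N : R) (A_AdS phi_AdS A phi : R -> R)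
    (hG : 0 < G_N)
    (hAdS : proper_ads_wall A_AdS phi_AdS)
    (hflat : proper_flat_wall A phi)
    (hcorr : corresponding_scalars phi_AdS phi) :
  (forall r : R, A^`()%classic r != 0) /\
  (forall r_IR r_UV : R, r_IR < r_UV ->
     c_dw G_N A r_IR <= c_dw G_N A r_UV).
Proof.
have [[dA _] _] := flat_smooth hflat.
have {}dA r : derivable A r 1 by exact: (dA 0%N).
have [[dA' _] _] := flat_smooth hflat.
have {}dA' r : derivable A^`()%classic r 1 by exact: (dA' 1%N).
have A'anti : {homo A^`()%classic : x y /~ x <= y}.
  apply: nonincreasing_of_derive1_le0 => // r.
  (* Any chart point with radial coordinate [r] would do; the constant row is one. *)
  have := sol_einstein (flat_solution hflat) (const_mx r).
  move=> /(flat_einstein_rr _ dA); rewrite mxE => ->.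
  by rewrite oppr_le0 mulr_ge0// sqr_ge0.
have [r0 UV] := flat_UV_metric hflat.
have A'ge1 : forall r, 1 <= A^`()%classic r.
  apply: (@derive1_ge1_of_asymptote _ _ (0 - r0)) => //.
  have -> : (fun r => A r - r) = (fun r => A r - (r - r0) - r0).
    by apply/funext => r; lra.
  by apply: cvgB => //; exact: cvg_cst.
have A'gt0 r : 0 < A^`()%classic r by apply: lt_le_trans (A'ge1 r).
split=> [r|rI rU rIU]; first by rewrite gt_eqF.
apply: ler_wpM2l; first by rewrite divr_ge0// ltW.
by rewrite lef_pV2 ?posrE//; apply/A'anti/ltW.
Qed.
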